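(* For every positive integer $n$ there exist $n+1$ diagonal real $n\times n$ matrices $A_1,\ldots,A_{n+1}$ such that the tuple $(A_1,\ldots,A_{n+1})$ is hypercyclic on $\mathbb{R}^n$.
   Context: A tuple $(T_1,\ldots,T_m)$ of pairwise commuting $n\times n$ real matrices, regarded as linear operators on $\mathbb{R}^n$, is called hypercyclic on $\mathbb{R}^n$ if there exists a vector $x\in\mathbb{R}^n$ such that the set $\{T_1^{k_1}T_2^{k_2}\cdots T_m^{k_m}x : k_1,\ldots,k_m\in\mathbb{N}\cup\{0\}\}$ is dense in $\mathbb{R}^n$. Here $\mathbb{N}=\{1,2,3,\ldots\}$. *)

(* Defs.v *)
From HB Require Import structures.
From mathcomp Require Import all_boot all_order all_algebra.
From mathcomp Require Import all_classical all_reals all_analysis.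

Set Implicit Arguments.
Unset Strict Implicit.
Unset Printing Implicit Defensive.

Import Order.TTheory GRing.Theory Num.Theory.
Import numFieldNormedType.Exports.

Local Open Scope classical_set_scope.
Local Open Scope ring_scope.

(* The product is the ordered ring product of ['M[R]_n], so the orbit point is
   [T_0 ^ k_0 *m ... *m T_(m-1) ^ k_(m-1) *m x]; exponents may be 0. *)
Definition orbit_tuple (R : realType) (n m : nat) (T : 'I_m -> 'M[R]_n)
    (x : 'cV[R]_n) : set 'cV[R]_n :=
  [set (\prod_(i < m) T i ^+ k i) *m x | k in [set: 'I_m -> nat]].

Definition hypercyclic (R : realType) (n m : nat) (T : 'I_m -> 'M[R]_n) : Prop :=
  (forall i j, comm_mx (T i) (T j)) /\
  exists x : 'cV[R]_n, dense (orbit_tuple T x).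

(* Main.v *)
Require Import Defs.
From HB Require Import structures.
From mathcomp Require Import all_boot all_order all_algebra.
From mathcomp Require Import all_classical all_reals all_analysis.
From mathcomp Require Import ring lra.

Set Implicit Arguments.
Unset Strict Implicit.
Unset Printing Implicit Defensive.

Import Order.TTheory GRing.Theory Num.Theory.
Import numFieldNormedType.Exports.

Local Open Scope classical_set_scope.
Local Open Scope ring_scope.

(** Take as generators the [n] matrices [D_j] that agree with the identity
except for [- e] in the [j]-th diagonal entry, together with one contraction
[diag (e ^ (- b_1), ..., e ^ (- b_n))] with positive [b_j]. Started at the
all-ones vector, the orbit consists of the points whose [j]-th coordinate is
[e ^ (- p b_j) (- e) ^ l_j]. On a logarithmic scale this is [l_j - p b_j], and
the parity of [l_j] is the sign. Density of the orbit is therefore a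
simultaneous approximation property of the multiples [p b] modulo [2], and it
holds for a generic positive [b]. Only one such [b] is needed, and Baire's theorem
supplies it, so no arithmetic criterion for independence of the [b_j] has to be
proved.

The category argument is [baire_universality]: a family of continuous maps
[f_i : X -> Y] from a Banach space to a space with a countable pi-base has a
point [x] with dense [{f_i x}] as soon as every pair of nonempty open sets (one
in [X], one in [Y]) is linked by some [f_i]. Here [x]
is the exponent vector [b] and [f_i] is the orbit point with given exponents,
[orbit_map]. The link is [orbit_map_transitive]: for large [p], moving [b_j] by
less than [r] moves [p b_j] through an interval longer than [2], so any nonzero
[j]-th coordinate can be hit exactly with the right parity
([hit_coordinate]). Since the exponents [l_j] must be nonnegative, the [b_j]
have to stay positive; that is why [baire_universality] only asks for links
starting in a prescribed nonempty open set [P]. *)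

(** This makes the columns a Banach space, the setting of Baire's theorem. *)
HB.instance Definition _ (R : realType) (m n : nat) := Complete.on 'M[R]_(m, n).

(** For each member [B j] of the pi-base, the parameters sent into [B j] by some
[f i] form an open set, dense in [P] by the linking hypothesis. Adding the
exterior of [P] makes it dense in all of [X]; the sets so obtained have a common
point in [P] by Baire's theorem. *)
Lemma baire_universality (R : realType) (X : completeNormedModType R)
    (Y : topologicalType) (I : Type) (f : I -> X -> Y) (P : set X)
    (B : nat -> set Y) :
  (forall i, continuous (f i)) -> open P -> P !=set0 ->
  (forall j, open (B j) /\ B j !=set0) ->
  (forall V, open V -> V !=set0 -> exists j, B j `<=` V) ->
  (forall O V, open O -> O !=set0 -> O `<=` P -> open V -> V !=set0 ->
     exists i, O `&` f i @^-1` V !=set0) ->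
  exists x, dense [set f i x | i in [set: I]].
Proof.
move=> fc Po [p Pp] Bo Bbase ftrans.
pose G j := \bigcup_i (f i @^-1` B j) `|` ~` closure P.
have /Baire Gdense : forall j, open (G j) /\ dense (G j).
  move=> j; have [Bjo Bj0] := Bo j; split.
    apply: openU; last by apply: closed_openC; exact: closed_closure.
    by apply: bigcup_open => i _; apply: open_comp Bjo => x _; exact: fc.
  move=> O [u Ou] Oopen; have [clPo|nclPo] := pselect (closure P u); last first.
    by exists u; split => //; right.
  have [q [Pq Oq]] := clPo O (open_nbhs_nbhs (conj Oopen Ou)).
  have [||i [x [[Ox _] fx]]] := ftrans (O `&` P) (B j) (openI Oopen Po) _ _ Bjo Bj0.
  - by exists q.
  - by move=> ? [].
  - by exists x; split => //; left; exists i.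
have [x [Px Gx]] := Gdense P (ex_intro _ p Pp) Po.
exists x => V V0 Vo; have [j BV] := Bbase V Vo V0.
case: (Gx j Logic.I) => [[i _ fx]|]; first by exists (f i x); split; [exact: BV|exists i].
by case; exact: subset_closure.
Qed.

(** A countable pi-base of the column space, numbered by the pairs (rational
centre, inverse radius) through [unpickle]; codes of no pair give the whole
space, which keeps every member nonempty. *)
Definition rational_ball (R : realType) (n : nat) (j : nat) : set 'cV[R]_n :=
  if @unpickle ('cV[rat]_n * nat)%type j is Some (q, m)
  then ball (map_mx ratr q : 'cV[R]_n) m.+1%:R^-1 else setT.

Lemma rational_ball_open (R : realType) n j : open (@rational_ball R n j).
Proof.
rewrite /rational_ball; case: unpickle => [[q m]|]; last exact: openT.
by apply: ball_open; rewrite invr_gt0 ltr0n.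
Qed.

Lemma rational_ball_neq0 (R : realType) n j : @rational_ball R n j !=set0.
Proof.
rewrite /rational_ball; case: unpickle => [[q m]|]; last by exists 0.
by exists (map_mx ratr q); apply: ballxx; rewrite invr_gt0 ltr0n.
Qed.

Lemma rational_ball_base (R : realType) n (V : set 'cV[R]_n) :
  open V -> V !=set0 -> exists j, @rational_ball R n j `<=` V.
Proof.
move=> Vo [z Vz]; have /nbhs_ballP[e /= e0 zeV] := open_nbhs_nbhs (conj Vo Vz).
pose m := Num.trunc (e / 2)^-1.
have m0 : 0 < m.+1%:R^-1 :> R by rewrite invr_gt0 ltr0n.
have me : m.+1%:R^-1 < e / 2.
  by rewrite invf_plt ?posrE ?ltr0n ?divr_gt0// truncnS_gt.
have /choice[q zq] : forall i, exists q : rat,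
    z i 0 - m.+1%:R^-1 < ratr q < z i 0 + m.+1%:R^-1.
  move=> i; have [|q] := @rat_in_itvoo R (z i 0 - m.+1%:R^-1) (z i 0 + m.+1%:R^-1).
    by rewrite ltrD2l gtrN.
  by rewrite in_itv/=; exists q.
exists (pickle (\col_i q i, m)); rewrite /rational_ball pickleK => x [_ qx].
apply: zeV; split=> // i j; have := qx i j; rewrite !mxE !ord1.
have /andP[] := zq i; rewrite -!ball_normE /= !ltr_norml.
by move: me; move: (m.+1%:R^-1) => d; lra.
Qed.

(** Orbit points never have a zero coordinate, so the targets that are to be hit
exactly must avoid the coordinate hyperplanes. *)
Lemma open_nonzero_coords (R : realType) n (V : set 'cV[R]_n) :
  open V -> V !=set0 -> exists2 y, V y & forall i, y i 0 != 0.
Proof.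
move=> Vo [z Vz]; have /nbhs_ballP[e /= e0 zeV] := open_nbhs_nbhs (conj Vo Vz).
have e20 : 0 < e / 2 by rewrite divr_gt0.
exists (\col_i if z i 0 == 0 then e / 2 else z i 0); last first.
  by move=> i; rewrite mxE; case: ifPn => // _; rewrite gt_eqF.
apply: zeV; split=> // i j; rewrite !mxE ord1 -ball_normE /=.
case: eqP => [->|_]; last by rewrite subrr normr0.
by rewrite sub0r normrN gtr0_norm// ltr_pdivrMr// ltr_pMr// ltr1n.
Qed.

(** With [a = ln |y|], the equation for [(l, c)] says that [k c = l - a] and that
[l] is odd exactly when [y < 0]. Taking for [l] a natural number of that parity
close to [t = k b + a] gives [|b - c| = |t - l| / k], where [|t - l|] is bounded
independently of [k]. The sign condition on [b] bounds [t] from below by [a],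
so that a nonnegative [l] is available. *)
Lemma hit_coordinate (R : realType) (b r y : R) :
  0 <= b -> 0 < r -> y != 0 ->
  exists K, forall k, (K <= k)%N -> exists lc : nat * R,
    `|b - lc.2| < r /\ expR (- lc.2) ^+ k * (- expR 1) ^+ lc.1 = y.
Proof.
move=> b0 r0 y0; pose a := ln `|y|.
exists (Num.trunc ((2 + `|a|) / r)).+1 => k Kk.
have kr : 2 + `|a| < k%:R * r.
  rewrite -ltr_pdivrMr//; apply: lt_le_trans (truncnS_gt _) _.
  by rewrite ler_nat.
have k0 : 0 < k%:R :> R by rewrite ltr0n; case: k Kk {kr}.
(* [s] is the parity prescribed by the sign of [y]; [Num.trunc] is 0 on
   negative numbers, so [l = s] when [t < 0]. *)
pose t := k%:R * b + a.
pose s : nat := (y < 0)%R.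
pose l := (s + (Num.trunc (t / 2)).*2)%N.
have tl : `|t - l%:R| <= 2 + `|a|.
  have s1 : 0 <= (s%:R : R) <= 1 by rewrite ler0n lern1 leq_b1.
  rewrite /l -mul2n natrD natrM; have kb : 0 <= k%:R * b by rewrite mulr_ge0// ltW.
  have [t0|t0] := leP 0 t.
    have /andP[] := truncn_itv (divr_ge0 t0 (ler0n R 2)).
    by rewrite -(natr1 (Num.trunc _)) ler_norml; have := normr_ge0 a; lra.
  rewrite truncn_floor ifF; last by rewrite leNgt pmulr_llt0 ?invr_gt0// t0.
  rewrite mulr0 addr0; move: t0; rewrite /t; have := ler_norm (- a).
  by rewrite normrN ler_norml; lra.
exists (l, (l%:R - a) / k%:R); split=> /=.
  have -> : b - (l%:R - a) / k%:R = (t - l%:R) / k%:R.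
    by rewrite /t; field; rewrite gt_eqF.
  rewrite normrM normfV (gtr0_norm k0) ltr_pdivrMr//.
  by rewrite (mulrC r); exact: le_lt_trans kr.
rewrite -expRM_natl.
have -> : k%:R * - ((l%:R - a) / k%:R) = a - l%:R by field; rewrite gt_eqF.
rewrite exprNn expRD lnK ?posrE ?normr_gt0// expRN -expRM_natl mulr1.
rewrite mulrA mulrAC mulfVK ?gt_eqF ?expR_gt0//.
by rewrite /l exprD -mul2n exprM sqrrN !expr1n mulr1 mulrC -numEsign.
Qed.

Lemma prod_diag_mx (R : comPzRingType) (n m : nat) (d : 'I_m -> 'rV[R]_n)
    (k : 'I_m -> nat) :
  \prod_(i < m) diag_mx (d i) ^+ k i =
  diag_mx (\row_j \prod_(i < m) d i 0 j ^+ k i).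
Proof.
have dX (v : 'rV[R]_n) p : diag_mx v ^+ p = diag_mx (\row_j v 0 j ^+ p).
  elim: p => [|p IHp].
    by apply/matrixP => i j; rewrite !mxE expr0.
  rewrite exprS IHp -[LHS]/(_ *m _) mulmx_diag; congr diag_mx.
  by apply/rowP => j; rewrite !mxE exprS.
elim: m d k => [|m IHm] d k.
  by rewrite big_ord0; apply/matrixP => i j; rewrite !mxE big_ord0.
rewrite big_ord_recl IHm dX -[LHS]/(_ *m _) mulmx_diag; congr diag_mx.
by apply/rowP => j; rewrite !mxE big_ord_recl.
Qed.

Definition generator (R : realType) n (b : 'cV[R]_n) (i : 'I_n.+1) : 'rV[R]_n :=
  \row_j if unlift ord0 i is Some h then if h == j then - expR 1 else 1
         else expR (- b j 0).

Definition orbit_map (R : realType) n (k : 'I_n.+1 -> nat) (b : 'cV[R]_n) :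
    'cV[R]_n :=
  \col_j (expR (- b j 0) ^+ k ord0 * (- expR 1) ^+ k (lift ord0 j)).

Lemma orbit_mapE (R : realType) n (k : 'I_n.+1 -> nat) (b : 'cV[R]_n) :
  (\prod_(i < n.+1) diag_mx (generator b i) ^+ k i) *m const_mx 1 = orbit_map k b.
Proof.
rewrite prod_diag_mx mul_diag_mx; apply/colP => j; rewrite !mxE mulr1.
rewrite big_ord_recl !mxE unlift_none; congr (_ * _).
rewrite (bigD1 j)//= !mxE liftK eqxx big1 ?mulr1// => i ij.
by rewrite !mxE liftK (negbTE ij) expr1n.
Qed.

Lemma orbit_map_continuous (R : realType) n (k : 'I_n.+1 -> nat) :
  continuous (@orbit_map R n k).
Proof.
have hc p c : continuous (fun u : R => expR (- u) ^+ p * c).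
  move=> u; apply: cvgM; last exact: cvg_cst.
  apply: (@continuous_comp _ _ _ (fun v : R => expR (- v)) (fun v : R => v ^+ p)).
    by apply: continuous_comp; [exact: oppr_continuous|exact: continuous_expR].
  exact: exprn_continuous.
move=> b A /nbhs_ballP[e /= e0 bA].
have coord i : \forall x \near b,
    ball (orbit_map k b i 0) e (orbit_map k x i 0).
  have := @continuous_comp _ _ _ (fun x : 'cV[R]_n => x i 0) _ b
    (@coord_continuous _ _ _ i 0 b) (hc (k ord0) ((- expR 1) ^+ k (lift ord0 i)) _).
  move/(_ _ (nbhsx_ballx _ _ e0)); apply: (@filterS _ (nbhs b)) => x /=.
  by rewrite !mxE.
have near_b := @filter_forall _ _ _ (nbhs b) (nbhs_filter b) coord.
rewrite -[nbhs _ A]/(nbhs b (orbit_map k @^-1` A)).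
apply: (@filterS _ (nbhs b) _ _ _ _ near_b) => x bx.
by apply: bA; split=> // i j; rewrite ord1.
Qed.

(** The exponent of the contraction is common to all coordinates while
[hit_coordinate] yields one threshold for each of them; their sum is at
least each of them. The ball around the all-ones vector serves as an open set of vectors
with positive coordinates. *)
Lemma orbit_map_transitive (R : realType) n (O V : set 'cV[R]_n) :
  open O -> O !=set0 -> O `<=` ball (const_mx 1 : 'cV[R]_n) 1 ->
  open V -> V !=set0 ->
  exists k, O `&` orbit_map k @^-1` V !=set0.
Proof.
move=> Oo [b Ob] OP Vo V0.
have [y Vy y0] := open_nonzero_coords Vo V0.
have /nbhs_ballP[r /= r0 brO] := open_nbhs_nbhs (conj Oo Ob).
have b0 j : 0 <= b j 0.
  have [_ /(_ j 0)] := OP b Ob; rewrite -ball_normE /= mxE ltr_norml; lra.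
have /choice[K HK] := fun j => hit_coordinate (b0 j) r0 (y0 j).
have /choice[lc Hlc] : forall j, exists lc : nat * R, `|b j 0 - lc.2| < r /\
    expR (- lc.2) ^+ (\sum_i K i)%N * (- expR 1) ^+ lc.1 = y j 0.
  by move=> j; apply: HK; rewrite (bigD1 j)//= leq_addr.
exists (fun i => if unlift ord0 i is Some j then (lc j).1 else (\sum_i K i)%N).
exists (\col_j (lc j).2); split.
  by apply: brO; split => // i j; rewrite ord1 -ball_normE /= mxE; have [] := Hlc i.
rewrite /preimage /= (_ : orbit_map _ _ = y)//.
by apply/colP => j; rewrite !mxE unlift_none liftK; have [] := Hlc j.
Qed.

Theorem theorem3p1 (R : realType) (n : nat) (n_gt0 : (0 < n)%N) :
  exists A : 'I_n.+1 -> 'M[R]_n,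
    (forall i, is_diag_mx (A i)) /\ hypercyclic A.
Proof.
have [||||||b bdense] := @baire_universality R 'cV[R]_n 'cV[R]_n _ (@orbit_map R n)
  (ball (const_mx 1 : 'cV[R]_n) 1) (@rational_ball R n).
- exact: orbit_map_continuous.
- exact: ball_open.
- by exists (const_mx 1); exact: ballxx.
- by move=> j; split; [exact: rational_ball_open|exact: rational_ball_neq0].
- exact: rational_ball_base.
- exact: orbit_map_transitive.
exists (fun i => diag_mx (generator b i)); split=> [i|].
  exact: diag_mx_is_diag.
split=> [i j|]; first exact: diag_mxC.
exists (const_mx 1).
suff -> : orbit_tuple (fun i => diag_mx (generator b i)) (const_mx 1)
  = [set orbit_map k b | k in [set: 'I_n.+1 -> nat]] by [].
by apply: eq_imagel => k _; exact: orbit_mapE.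
Qed.
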